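(* Let $\Theta\subseteq\mathbb R^d$ and let $\mathbf x=(\mathbf x_1,\dots,\mathbf x_n)\in\mathcal X^n$ be generated i.i.d. from the model $p(\cdot\mid\boldsymbol\theta)$ with true parameter $\boldsymbol\theta_0\in\operatorname{int}(\Theta)$. Let $\ell(\boldsymbol\theta)=\sum_{i=1}^n\log p(\mathbf x_i\mid\boldsymbol\theta)$, let $I(\boldsymbol\theta)$ be the per-observation Fisher information matrix, $K(\boldsymbol\theta)=nI(\boldsymbol\theta)$, $\pi$ a prior density on $\Theta$, $\hat{\boldsymbol\theta}_{\rm MLE}$ the maximum likelihood estimator, and $\hat{\boldsymbol\theta}_{\rm WF}$ the Wallace--Freeman estimator $$\hat{\boldsymbol\theta}_{\rm WF}=\arg\min_{\boldsymbol\theta\in\Theta}\{-\ell(\boldsymbol\theta)+\operatorname{pen}(\boldsymbol\theta)\},\qquad \operatorname{pen}(\boldsymbol\theta)=-\log\pi(\boldsymbol\theta)+\tfrac12\log|I(\boldsymbol\theta)|.$$ Let $\mathbf a(\boldsymbol\theta):=-\nabla_\theta\operatorname{pen}(\boldsymbol\theta)=\nabla_\theta\log\pi(\boldsymbol\theta)-\frac12\nabla_\theta\log|I(\boldsymbol\theta)|$. Assume that: (C1) $\ell(\boldsymbol\theta)$ is twice continuously differentiable in a neighbourhood of $\boldsymbol\theta_0$, $\hat{\boldsymbol\theta}_{\rm MLE}$ is an interior root-$n$ consistent solution of $\nabla\ell(\boldsymbol\theta)=0$, and $\hat{\boldsymbol\theta}_{\rm MLE}$ satisfies the Cox--Snell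 expansion $\operatorname{Bias}(\hat{\boldsymbol\theta}_{\rm MLE})=K(\boldsymbol\theta_0)^{-1}A(\boldsymbol\theta_0)\operatorname{vec}(K(\boldsymbol\theta_0)^{-1})+O(n^{-2})$, where $A(\boldsymbol\theta_0)$ is the Cox--Snell cumulant matrix; (C2) $-\nabla^2\ell(\hat{\boldsymbol\theta}_{\rm MLE})=K(\boldsymbol\theta_0)+O_p(n^{1/2})$, with $K(\boldsymbol\theta_0)$ nonsingular; (C3) $\hat{\boldsymbol\theta}_{\rm MLE}-\boldsymbol\theta_0=O_p(n^{-1/2})$; (C4) $\mathbf a(\boldsymbol\theta)$ is continuously differentiable in a neighbourhood of $\boldsymbol\theta_0$; (C5) the remainder $R_n=\nabla\ell(\hat{\boldsymbol\theta}_{\rm WF})-\nabla\ell(\hat{\boldsymbol\theta}_{\rm MLE})-\nabla^2\ell(\hat{\boldsymbol\theta}_{\rm MLE})(\hat{\boldsymbol\theta}_{\rm WF}-\hat{\boldsymbol\theta}_{\rm MLE})$ in the first-order Taylor expansion of $\nabla\ell(\hat{\boldsymbol\theta}_{\rm WF})$ about $\hat{\boldsymbol\theta}_{\rm MLE}$ is $o_p(n^{-1})$, and the corresponding error term $\hat{\boldsymbol\theta}_{\rm WF}-\hat{\boldsymbol\theta}_{\rm MLE}-K(\boldsymbol\theta_0)^{-1}\mathbf a(\boldsymbol\theta_0)$ is uniformly integrable after multiplication by $n$. If $\pi(\boldsymbol\theta)\propto|I(\boldsymbol\theta)|^{1/2}$, then $\mathbf a(\boldsymbol\theta)\equiv0$,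 so $$\hat{\boldsymbol\theta}_{\rm WF}-\hat{\boldsymbol\theta}_{\rm MLE}=o_p(n^{-1}),$$ and the two estimators have the same $O(n^{-1})$ bias, that is, $\operatorname{Bias}(\hat{\boldsymbol\theta}_{\rm WF})=\operatorname{Bias}(\hat{\boldsymbol\theta}_{\rm MLE})+o(n^{-1})$. If instead $\pi(\boldsymbol\theta)\propto|I(\boldsymbol\theta)|$, then $$\mathbf a(\boldsymbol\theta)=\tfrac12\nabla_\theta\log|I(\boldsymbol\theta)|,$$ and, in canonical exponential families, minimising the Wallace--Freeman codelength $-\ell(\boldsymbol\theta)+\operatorname{pen}(\boldsymbol\theta)$ is equivalent to maximising Firth's penalised likelihood.
   Context: $|M|$ is the determinant of a matrix $M$, and $\operatorname{Bias}(\hat{\boldsymbol\theta})=\mathbb E_{\boldsymbol\theta_0}(\hat{\boldsymbol\theta}-\boldsymbol\theta_0)$. All stochastic orders are under $\boldsymbol\theta_0$ as $n\to\infty$. Cumulant matrix: write $\ell_{ij}=\partial^2\ell/\partial\theta_i\partial\theta_j$, $\ell_{ijk}=\partial^3\ell/\partial\theta_i\partial\theta_j\partial\theta_k$, $\kappa_{ij}(\boldsymbol\theta)=\mathbb E_{\boldsymbol\theta}\{\ell_{ij}(\boldsymbol\theta)\}$, $\kappa_{ijk}(\boldsymbol\theta)=\mathbb E_{\boldsymbol\theta}\{\ell_{ijk}(\boldsymbol\theta)\}$, $\kappa_{ij}^{(l)}=\partial\kappa_{ij}/\partial\theta_l$. Then $K(\boldsymbol\theta)=\{-\kappa_{ij}(\boldsymbol\theta)\}=nI(\boldsymbol\theta)$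 and the $(d\times d^2)$ Cox--Snell cumulant matrix is $A=[A^{(1)}\mid\cdots\mid A^{(d)}]$ with $A^{(l)}=\{a^{\,l}_{ij}\}_{i,j=1}^d$, $a_{ij}^{\,l}=\kappa_{ij}^{(l)}-\frac12\kappa_{ijl}$; $A(\boldsymbol\theta_0)$ is its value at $\boldsymbol\theta_0$. $\operatorname{vec}$ stacks the columns of a matrix. Firth's penalised likelihood in a canonical exponential family (with $\boldsymbol\theta$ the canonical parameter) is the likelihood multiplied by the Jeffreys factor, i.e. on the log scale $\ell(\boldsymbol\theta)+\frac12\log|K(\boldsymbol\theta)|$, which equals $\ell(\boldsymbol\theta)+\frac12\log|I(\boldsymbol\theta)|$ up to an additive constant not depending on $\boldsymbol\theta$. The Wallace--Freeman codelength is $-\ell(\boldsymbol\theta)-\log\pi(\boldsymbol\theta)+\frac12\log|I(\boldsymbol\theta)|$ up to constants not depending on $\boldsymbol\theta$. *)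

(* Defs.v *)
From HB Require Import structures.
From mathcomp Require Export all_boot all_order all_algebra.
From mathcomp Require Export all_classical all_reals all_analysis.

Set Implicit Arguments.
Unset Strict Implicit.
Unset Printing Implicit Defensive.

Import Order.TTheory GRing.Theory Num.Theory.
Import numFieldNormedType.Exports.

Local Open Scope classical_set_scope.
Local Open Scope ring_scope.

Section Optimisation.
Context {T : Type} {R : realType}.

Definition is_argmin (D : set T) (f : T -> \bar R) (t : T) : Prop :=
  D t /\ forall s, D s -> (f t <= f s)%E.

Definition is_argmax (D : set T) (f : T -> \bar R) (t : T) : Prop :=
  D t /\ forall s, D s -> (f s <= f t)%E.

End Optimisation.

Section Calculus.
Context {R : realType} {d : nat}.

Definition partial (i : 'I_d) (f : 'cV[R]_d -> R) : 'cV[R]_d -> R :=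
  fun t => derive f t (delta_mx i 0).

Definition has_partials (f : 'cV[R]_d -> R) (t : 'cV[R]_d) : Prop :=
  forall i : 'I_d, derivable f t (delta_mx i 0).

Definition gradient (f : 'cV[R]_d -> R) (t : 'cV[R]_d) : 'cV[R]_d :=
  \col_i partial i f t.

Definition hessian (f : 'cV[R]_d -> R) (t : 'cV[R]_d) : 'M[R]_d :=
  \matrix_(i, j) partial j (partial i f) t.

Definition C1_on (U : set 'cV[R]_d) (f : 'cV[R]_d -> R) : Prop :=
  forall t, U t ->
    has_partials f t /\ forall i, {for t, continuous (partial i f)}.

Definition C2_on (U : set 'cV[R]_d) (f : 'cV[R]_d -> R) : Prop :=
  C1_on U f /\ forall i, C1_on U (partial i f).

(* [vec] stacks columns whereas the library's [mxvec] concatenates rows;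
   entry [mxvec_index l j] of [vec M] is [M j l]. *)
Definition vec (M : 'M[R]_d) : 'cV[R]_(d * d) := (mxvec M^T)^T.

End Calculus.

(* A statistic of a sample of size [n] is a function on [n.-tuple X]; the laws
   of the samples of size 0, 1, 2, ... form the sequence [P].  The arguments of
   [P] below need not be measurable, hence the outer probability [(P n)^*]. *)
Section StochasticOrders.
Context {R : realType} {dX : measure_display} {X : measurableType dX}.
Context {V : normedModType R}.
Variables (P : forall n, probability (n.-tuple X) R).
Variables (Z : forall n, n.-tuple X -> V).

Definition bigOp (r : nat -> R) : Prop :=
  forall e : R, 0 < e -> exists M : R, \forall n \near \oo,
    ((P n)^*%mu [set x | M * r n < `|Z x|]%R <= e%:E)%E.

Definition littleop (r : nat -> R) : Prop :=
  forall e : R, 0 < e ->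
    (P n)^*%mu [set x | e * r n < `|Z x|]%R @[n --> \oo] --> 0%E.

(* Only the tail of the sequence matters, as for the orders above. *)
Definition uniformly_integrable : Prop :=
  forall e : R, 0 < e -> exists M : R, \forall n \near \oo,
    (\int[P n]_(x in [set x | M < `|Z x|]%R) (`|Z x|)%:E <= e%:E)%E.

End StochasticOrders.

Section Estimators.
Context {R : realType} {dX : measure_display} {X : measurableType dX} {d n : nat}.

(* Coordinatewise, i.e. Borel measurability into R^d. *)
Definition measurable_estimator (est : n.-tuple X -> 'cV[R]_d) : Prop :=
  forall i, measurable_fun [set: n.-tuple X] (fun x => est x i 0).

Definition integrable_estimator (P : probability (n.-tuple X) R)
    (est : n.-tuple X -> 'cV[R]_d) : Prop :=
  forall i, P.-integrable setT (fun x => (est x i 0)%:E).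

Definition Bias (P : probability (n.-tuple X) R)
    (est : n.-tuple X -> 'cV[R]_d) (t0 : 'cV[R]_d) : 'cV[R]_d :=
  \col_i fine ('E_P[fun x => ((est x - t0) i 0)%R])%E.

End Estimators.

Section Model.
Context {R : realType} {dX : measure_display} {X : measurableType dX} {d : nat}.
Variables (mu : {sigma_finite_measure set X -> \bar R}).
Variables (Theta : set 'cV[R]_d) (p : X -> 'cV[R]_d -> R).
Variables (P : forall n, 'cV[R]_d -> probability (n.-tuple X) R).

(* [P n t] is the law of [n] i.i.d. observations with density [p ^~ t]: it is
   the product law on rectangles, which determines it. The case [n = 1] says
   that [p ^~ t] is a probability density. *)
Definition is_iid_model : Prop :=
  forall t, Theta t ->
    [/\ measurable_fun [set: X] (p ^~ t),
        forall x, 0 <= p x t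
      & forall n (A : 'I_n -> set X), (forall i, measurable (A i)) ->
          P n t [set x | forall i, A i (tnth x i)] =
          (\prod_(i < n) \int[mu]_(x in A i) (p x t)%:E)%E].

(* Extended-real valued, with log 0 = -oo. *)
Definition loglik n (x : n.-tuple X) (t : 'cV[R]_d) : \bar R :=
  (\sum_(i < n) lne (p (tnth x i) t)%:E)%E.

(* For differentiation, at parameters where [loglik] is finite. *)
Definition rloglik n (x : n.-tuple X) (t : 'cV[R]_d) : R := fine (loglik x t).

Definition kappa2 n (i j : 'I_d) (t : 'cV[R]_d) : R :=
  fine ('E_(P n t)[fun x => partial j (partial i (rloglik x)) t])%E.

Definition kappa3 n (i j k : 'I_d) (t : 'cV[R]_d) : R :=
  fine ('E_(P n t)[fun x =>
    partial k (partial j (partial i (rloglik x))) t])%E.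

(* Entry (i, mxvec_index l j) is a_{ij}^l, so that this is the block matrix
   [A^(1) | ... | A^(d)]. *)
Definition cox_snell_mx n (t : 'cV[R]_d) : 'M[R]_(d, d * d) :=
  \matrix_(i < d) mxvec (\matrix_(l < d, j < d)
    (partial l (kappa2 n i j) t - 2^-1 * kappa3 n i j l t)).

(* Minus the mean Hessian of the log-likelihood of one observation, so that
   {- kappa_ij} = n I. *)
Definition fisher (t : 'cV[R]_d) : 'M[R]_d :=
  \matrix_(i, j) - kappa2 1 i j t.

Definition info n (t : 'cV[R]_d) : 'M[R]_d := n%:R *: fisher t.

(* [t] is the canonical parameter, [h] the base density, [s] the sufficient
   statistic and [b] the log-partition function. *)
Definition canonical_expfam : Prop :=
  exists (h : X -> R) (s : X -> 'cV[R]_d) (b : 'cV[R]_d -> R),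
    forall x t, Theta t ->
      p x t = h x * expR ((t^T *m s x) 0 0 - b t).

Definition firth n (x : n.-tuple X) (t : 'cV[R]_d) : \bar R :=
  (loglik x t + (2^-1)%:E * lne (\det (info n t))%:E)%E.

End Model.

Section WallaceFreeman.
Context {R : realType} {d : nat}.
Variables (Theta : set 'cV[R]_d).

(* Density with respect to a reference measure [nu] on the Borel sets of R^d
   (Lebesgue measure in the usual case), supported in [Theta]. *)
Definition prior_density
    (nu : {measure set (g_sigma_algebraType (@open 'cV[R]_d)) -> \bar R})
    (prior : 'cV[R]_d -> R) : Prop :=
  [/\ measurable_fun [set: g_sigma_algebraType (@open 'cV[R]_d)] prior,
      forall t, 0 <= prior t,
      forall t, ~ Theta t -> prior t = 0
    & (\int[nu]_t (prior t)%:E = 1)%E].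

Variables (prior : 'cV[R]_d -> R) (I : 'cV[R]_d -> 'M[R]_d).

Definition pen (t : 'cV[R]_d) : \bar R :=
  (- lne (prior t)%:E + (2^-1)%:E * lne (\det (I t))%:E)%E.

(* For differentiation, at parameters where [pen] is finite. *)
Definition rpen (t : 'cV[R]_d) : R := fine (pen t).

Definition pen_score (t : 'cV[R]_d) : 'cV[R]_d := - gradient rpen t.

End WallaceFreeman.

(* Main.v *)
Require Import Defs.
From mathcomp Require Import lra ring measurable_realfun.

Set Implicit Arguments.
Unset Strict Implicit.
Unset Printing Implicit Defensive.

Import Order.TTheory GRing.Theory Num.Theory.
Import numFieldNormedType.Exports.

Local Open Scope classical_set_scope.
Local Open Scope ring_scope.

(* If the prior is proportional to |I|^(1/2), the penalty is constant on Theta,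
   so a = 0 and the Wallace-Freeman estimator maximises the likelihood too.
   Its consistency is not a hypothesis: with a(theta0) = 0, uniform
   integrability of n (wf - mle) gives wf - mle = O_p(1/n) by Markov, so wf is
   eventually interior with high probability and its score vanishes.  The
   Taylor expansion then reads n I(theta0) (wf - mle) = o_p(1/n) +
   O_p(sqrt n) O_p(1/n), whence wf - mle = o_p(1/n), and uniform integrability
   turns this into convergence of n E|wf - mle| to 0.  If the prior is
   proportional to |I|, the penalty is a constant minus half of log |I|. *)

(** * Directional derivatives at a local maximum *)

(** Difference quotients are nonpositive for small positive steps and nonnegative for small negative
    ones, and both one-sided limits equal the derivative. *)
Lemma derive_local_max (R : realType) (V : normedModType R) (f : V -> R)
    (x v : V) :
  derivable f x v -> (\forall y \near x, f y <= f x) -> 'D_v f x = 0.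
Proof.
move=> df fmax.
have near_max : \forall h \near (0 : R), f (h *: v + x) <= f x.
  have : (h *: v + x) @[h --> (0 : R)] --> x.
    rewrite -[X in _ --> X]add0r -(scale0r v).
    by apply: cvgD; [apply: cvgZr_tmp; exact: cvg_id | exact: cvg_cst].
  by move=> /(_ _ fmax).
apply/eqP; rewrite eq_le; apply/andP; split; rewrite /derive.
  rewrite cvg_at_rightE //; apply: limr_le; first exact: cvgP (cvg_dnbhs_at_right df).
  near=> h; apply: mulr_ge0_le0 => /=; first by rewrite invr_ge0 ltW.
  by rewrite subr_le0; near: h; exact: cvg_within near_max.
rewrite cvg_at_leftE //; apply: limr_ge; first exact: cvgP (cvg_dnbhs_at_left df).
near=> h; apply: mulr_le0 => /=; first by rewrite invr_le0 ltW.
by rewrite subr_le0; near: h; exact: cvg_within near_max.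
Unshelve. all: by end_near. Qed.

(** * The maximum norm on matrices *)

Lemma mx_norm_coord_le (R : realType) m n (A : 'M[R]_(m, n)) i j :
  `|A i j| <= `|A|.
Proof.
rewrite [leRHS]/Num.norm /= mx_normrE.
by apply: (le_bigmax _ (fun ij => `|A ij.1 ij.2|) (i, j)).
Qed.

Lemma mx_norm_leP (R : realType) m n (A : 'M[R]_(m, n)) (c : R) : 0 <= c ->
  reflect (forall i j, `|A i j| <= c) (`|A| <= c).
Proof.
move=> c0; apply: (iffP idP) => [Ac i j|Ac].
  exact: le_trans (mx_norm_coord_le A i j) Ac.
rewrite [leLHS]/Num.norm /= mx_normrE; apply/bigmax_leP; split=> // ij _; exact: Ac.
Qed.

(** The norm is the largest absolute entry, and each entry of the product is a sum of [n] terms;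
    hence the factor [n]. *)
Lemma mx_norm_mulmx_le (R : realType) m n p (A : 'M[R]_(m, n)) (B : 'M[R]_(n, p)) :
  `|A *m B| <= n%:R * (`|A| * `|B|).
Proof.
apply/mx_norm_leP; first by rewrite !mulr_ge0.
move=> i k; rewrite mxE; apply: le_trans (ler_norm_sum _ _ _) _.
apply: (@le_trans _ _ (\sum_(j < n) `|A| * `|B|)); last first.
  by rewrite sumr_const card_ord mulr_natl.
by apply: ler_sum => j _; rewrite normrM ler_pM// mx_norm_coord_le.
Qed.

(** * Outer measures and measurability of norms *)

Lemma mu_ext_negligible d (T : measurableType d) (R : realType)
    (mu : {measure set T -> \bar R}) (N : set T) :
  mu.-negligible N -> (mu^* N)%mu = 0%E.
Proof.
move=> [A [mA A0 NA]]; apply/eqP; rewrite eq_le mu_ext_ge0 // andbT.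
by rewrite -A0 -(measurable_mu_extE mu mA) le_mu_ext.
Qed.

Lemma mu_extU_le d (T : measurableType d) (R : realType)
    (mu : {measure set T -> \bar R}) (A B : set T) (a b : R) :
  (mu^* A <= a%:E)%mu%E -> (mu^* B <= b%:E)%mu%E ->
  (mu^* (A `|` B) <= (a + b)%:E)%mu%E.
Proof.
by move=> Aa Bb; apply: le_trans (outer_measureU2 _ _ _) _; rewrite EFinD leeD.
Qed.

Lemma measurable_mx_norm d (T : measurableType d) (R : realType) m
    (f : T -> 'cV[R]_m) :
  (forall i, measurable_fun setT (fun x => f x i 0)) ->
  measurable_fun setT (fun x => `|f x|).
Proof.
move=> mf.
suff: measurable_fun setT (fun x => \big[Num.max/0]_(ij : 'I_m * 'I_1) `|f x ij.1 ij.2|).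
  by apply: eq_measurable_fun => x _; rewrite [RHS]/Num.norm /= mx_normrE.
elim: (index_enum _) => [|ij s IHs].
  by under eq_fun do rewrite big_nil; exact: measurable_cst.
under eq_fun do rewrite big_cons.
apply: measurable_maxr => //; apply: measurableT_comp => //.
by case: ij => i j /=; rewrite (ord1 j); exact: mf.
Qed.

(** * Stochastic orders *)

Lemma cvg_natr_inv (R : realType) : n%:R^-1 @[n --> \oo] --> (0 : R).
Proof. by rewrite -cvg_shiftS; exact: cvg_harmonic. Qed.

Lemma cvg_sqrtr_inv (R : realType) : (Num.sqrt n%:R)^-1 @[n --> \oo] --> (0 : R).
Proof.
under eq_fun do rewrite -sqrtrV //.
rewrite -sqrtr0.
by apply: continuous_cvg; [exact: sqrt_continuous | exact: cvg_natr_inv].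
Qed.

(** Trades convergence in the extended reals for an eventual real bound [h], so that finitely many
    exceptional events can be combined by subadditivity. *)
Lemma littleopP (R : realType) dX (X : measurableType dX) (V : normedModType R)
    (P : forall n, probability (n.-tuple X) R) (Z : forall n, n.-tuple X -> V)
    (r : nat -> R) :
  littleop P Z r <-> forall e h : R, 0 < e -> 0 < h -> \forall n \near \oo,
    ((P n)^*%mu [set x | e * r n < `|Z n x|]%R <= h%:E)%E.
Proof.
split=> [Zr e h e0 h0|Zr e e0].
  have /fine_cvgP[Pfin /cvgrPdist_le /(_ h h0) Ph] := Zr e e0.
  near=> n.
  have Pn : (P n)^*%mu [set x | e * r n < `|Z n x|]%R \is a fin_num by near: n.
  rewrite -(fineK Pn) lee_fin; apply: le_trans (ler_norm _) _.
  by rewrite -normrN -[- _]add0r; near: n.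
apply/fine_cvgP; split.
  have := Zr e 1 e0 ltr01; apply: filterS => n Pn1.
  by rewrite ge0_fin_numE ?mu_ext_ge0 // (le_lt_trans Pn1) // ltry.
apply/cvgrPdist_le => h h0; have := Zr e h e0 h0; apply: filterS => n Pnh.
rewrite sub0r normrN ger0_norm ?fine_ge0 ?mu_ext_ge0 //.
rewrite -lee_fin fineK // ge0_fin_numE ?mu_ext_ge0 //.
by rewrite (le_lt_trans Pnh) // ltry.
Unshelve. all: by end_near. Qed.

(** The event where [Z] and [Z'] differ costs an arbitrarily small outer probability. This serves to
    replace scores by zero when they vanish only with high probability. *)
Lemma littleop_eq (R : realType) dX (X : measurableType dX) (V : normedModType R)
    (P : forall n, probability (n.-tuple X) R) (Z Z' : forall n, n.-tuple X -> V)
    (r : nat -> R) :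
  (forall h : R, 0 < h -> \forall n \near \oo,
     ((P n)^*%mu [set x | Z n x <> Z' n x] <= h%:E)%E) ->
  littleop P Z r -> littleop P Z' r.
Proof.
move=> ZZ' /littleopP Zr; apply/littleopP => e h e0 h0.
near=> n; rewrite [h]splitr.
apply: (le_trans (y := (P n)^*%mu
  ([set x | e * r n < `|Z n x|]%R `|` [set x | Z n x <> Z' n x]))).
  apply: le_mu_ext => x /= Zx.
  by have [ZZx|ZZx] := pselect (Z n x = Z' n x); [left; rewrite ZZx|right].
by apply: mu_extU_le; near: n; [apply: Zr|apply: ZZ']; rewrite ?divr_gt0.
Unshelve. all: by end_near. Qed.

Lemma bigOp_cvg0 (R : realType) dX (X : measurableType dX) (V : normedModType R)
    (P : forall n, probability (n.-tuple X) R) (Z : forall n, n.-tuple X -> V)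
    (r : nat -> R) :
  bigOp P Z r -> r n @[n --> \oo] --> 0 -> littleop P Z (fun=> 1).
Proof.
move=> ZO r0; apply/littleopP => e h e0 h0.
have [M PM] := ZO h h0; near=> n.
apply: le_trans
  (_ : (_ <= (P n)^*%mu [set x | M * r n < `|Z n x|]%R)%E) _; last by near: n.
apply: le_mu_ext => x /=; rewrite mulr1; apply: le_lt_trans; near: n.
have : M * r n @[n --> \oo] --> 0 by rewrite -(mulr0 M); apply: cvgMl_tmp.
move=> /cvgrPdist_le /(_ e e0); apply: filterS => n; rewrite sub0r normrN.
exact: le_trans (ler_norm _).
Unshelve. all: by end_near. Qed.

(** * Uniform integrability: tightness and convergence in mean *)

Lemma measurable_lt_fun d (T : measurableType d) (R : realType) (f : T -> R) (M : R) :
  measurable_fun setT f -> measurable [set x | M < f x].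
Proof.
move=> mf; rewrite -[X in measurable X]setTI (_ : [set x | _] = f @^-1` `]M, +oo[).
  exact: mf.
by apply/seteqP; split => x /=; rewrite in_itv /= andbT.
Qed.

Lemma uniformly_integrable_bigOp (R : realType) dX (X : measurableType dX)
    (V : normedModType R) (P : forall n, probability (n.-tuple X) R)
    (Z : forall n, n.-tuple X -> V) :
  (forall n, measurable_fun setT (fun x => `|Z n x|)) ->
  uniformly_integrable P Z -> bigOp P Z (fun=> 1).
Proof.
(* Markov's inequality: with a threshold of at least 1, the norm dominates the indicator of the tail
   event. *)
move=> mZ uiZ e e0; have [M PM] := uiZ e e0; exists (Num.max M 1).
apply: filterS PM => n; apply: le_trans.
have mlt c : measurable [set x | c < `|Z n x|].
  by apply: measurable_lt_fun; exact: mZ.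
have mE D : measurable_fun D (fun x => (`|Z n x|)%:E).
  by apply: measurable_funTS; apply/measurable_EFinP; exact: mZ.
rewrite mulr1 measurable_mu_extE //.
rewrite -[leLHS]mul1e -integral_cst //.
apply: (@le_trans _ _
  (\int[P n]_(x in [set x | Num.max M 1 < `|Z n x|]%R) (`|Z n x|)%:E)%E).
  apply: ge0_le_integral => //.
  by move=> x /=; rewrite gt_max lee_fin => /andP[_ /ltW].
apply: ge0_subset_integral => //.
by move=> x /=; rewrite gt_max => /andP[].
Qed.

(** Integrates the pointwise bound of [z] by [e], plus [M] where [e < z], plus [z] itself where
    [M < z]; the constant [e] integrates to itself because [P] has mass 1. *)
Lemma integral_tail_le d (T : measurableType d) (R : realType)
    (P : probability T R) (z : T -> R) (e M : R) :
  measurable_fun setT z -> (forall x, 0 <= z x) -> 0 <= e -> 0 <= M ->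
  (\int[P]_x (z x)%:E <= e%:E + M%:E * P [set x | e < z x]%R +
     \int[P]_(x in [set x | M < z x]%R) (z x)%:E)%E.
Proof.
move=> mz z0 e0 M0.
have mA c : measurable [set x | c < z x] by apply: measurable_lt_fun; exact: mz.
have mE : measurable_fun setT (EFin \o z) by exact/measurable_EFinP.
have mr : measurable_fun setT ((EFin \o z) \_ [set x | M < z x]).
  by apply/(measurable_restrictT _ (mA M)).1; apply: measurable_funTS; exact: mE.
have mi : measurable_fun setT (fun x => (M * \1_[set x | e < z x] x)%:E).
  by apply/measurable_EFinP; apply: measurable_funM => //; exact: measurable_indic.
have r0 x : (0 <= ((EFin \o z) \_ [set x | M < z x]%R) x)%E.
  by apply: erestrict_ge0 => y _; rewrite lee_fin.
rewrite [X in (_ + X)%E]integral_mkcond.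
have -> : (M%:E * P [set x | e < z x]%R = \int[P]_x (M * \1_[set x | e < z x]%R x)%:E)%E.
  under eq_integral do rewrite EFinM.
  rewrite ge0_integralZl_EFin //.
  - by rewrite integral_indic // setIT.
  - by apply/measurable_EFinP; exact: measurable_indic.
have {1}-> : (e%:E = \int[P]_x e%:E)%E.
  by rewrite integral_cst;
    [rewrite [X in (_ * X)%E](@probability_setT _ _ _ P) mule1
    |exact: measurableT].
rewrite -ge0_integralD // => [|x _]; last by rewrite lee_fin mulr_ge0.
rewrite -ge0_integralD //.
- apply: ge0_le_integral => //.
  + by move=> x _; rewrite lee_fin.
  + by apply: emeasurable_funD => //; apply: emeasurable_funD.
  have memE c x : (x \in [set y | c < z y]%R) = (c < z x)%R.
    by apply/idP/idP; rewrite inE.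
  move=> x _; rewrite patchE indicE !memE.
  have [Mz|zM] := ltP M (z x); rewrite -?EFinD lee_fin.
    by rewrite lerDr addr_ge0 // mulr_ge0.
  rewrite addr0; have [ez|ze] := ltP e (z x); last by rewrite mulr0 addr0.
  by rewrite mulr1 (le_trans zM) // lerDr.
- by move=> x _; rewrite lee_fin addr_ge0 // mulr_ge0.
- by apply: emeasurable_funD.
Qed.

(** One direction of Vitali's theorem, with the laws varying in [n]: [integral_tail_le] splits the
    mean into three pieces, each at most [e / 4] eventually. *)
Lemma uniformly_integrable_cvg0 (R : realType) dX (X : measurableType dX)
    (V : normedModType R) (P : forall n, probability (n.-tuple X) R)
    (Z : forall n, n.-tuple X -> V) :
  (forall n, measurable_fun setT (fun x => `|Z n x|)) ->
  uniformly_integrable P Z -> littleop P Z (fun=> 1) ->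
  forall e : R, 0 < e ->
  \forall n \near \oo, (\int[P n]_x (`|Z n x|)%:E <= e%:E)%E.
Proof.
move=> mZ uiZ Z0 e e0; have e4 : 0 < e / 4 by rewrite divr_gt0.
have [M PM] := uiZ _ e4; pose M' := Num.max M 1.
have M'0 : 0 < M' by rewrite lt_max ltr01 orbT.
have /littleopP Z0' := Z0; near=> n.
have mlt c : measurable [set x | c < `|Z n x|].
  by apply: measurable_lt_fun; exact: mZ.
have mE D : measurable_fun D (fun x => (`|Z n x|)%:E).
  by apply: measurable_funTS; apply/measurable_EFinP; exact: mZ.
apply: le_trans (@integral_tail_le _ _ _ (P n) _ (e / 4) M' (mZ n) _ _ _) _ => //.
- exact: ltW.
- exact: ltW.
(* The division by [M'], positive as a maximum with 1, offsets the factor [M'] of the middle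
   piece. *)
have Pe : (P n [set x | e / 4 < `|Z n x|]%R <= (e / 4 / M')%:E)%E.
  rewrite -(measurable_mu_extE (P n)) // -[X in [set x | X < _]%R]mulr1.
  by near: n; apply: Z0' => //; rewrite divr_gt0.
have tail : (\int[P n]_(x in [set x | M' < `|Z n x|]%R) (`|Z n x|)%:E <= (e / 4)%:E)%E.
  apply: le_trans
    (_ : (_ <= \int[P n]_(x in [set x | M < `|Z n x|]%R) (`|Z n x|)%:E)%E) _;
    last by near: n.
  apply: ge0_subset_integral => //.
  by move=> x /=; rewrite gt_max => /andP[].
apply: (@le_trans _ _ ((e / 4)%:E + M'%:E * (e / 4 / M')%:E + (e / 4)%:E)%E).
  by apply: leeD => //; apply: leeD => //; rewrite lee_pmul2l.
have -> : (M'%:E * (e / 4 / M')%:E = (e / 4)%:E)%E.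
  by rewrite -EFinM mulrC divfK // gt_eqF.
by rewrite -!EFinD lee_fin; lra.
Unshelve. all: by end_near. Qed.

(** * The Newton step *)

(** Multiplying [D] by [n J] gives minus [H D] minus the Hessian error applied to [D]; inverting [J]
    bounds [D]. Each factor [d] comes from a matrix product. *)
Lemma newton_step_le (R : realType) d (J H : 'M[R]_d) (D : 'cV[R]_d) (n : nat) :
  (0 < n)%N -> J \in unitmx ->
  `|D| <= d%:R * `|invmx J| / n%:R * (`|H *m D| + d%:R * (`|- H - n%:R *: J| * `|D|)).
Proof.
move=> n0 Ju; have n0R : 0 < n%:R :> R by rewrite ltr0n.
have nD : n%:R *: D = invmx J *m (- (H *m D) - (- H - n%:R *: J) *m D).
  rewrite -mulNmx -mulmxBl opprB addrCA subrr addr0.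
  by rewrite -scalemxAl -scalemxAr mulKmx.
have -> : d%:R * `|invmx J| / n%:R * (`|H *m D| + d%:R * (`|- H - n%:R *: J| * `|D|))
    = n%:R^-1 * (d%:R * (`|invmx J| * (`|H *m D| + d%:R * (`|- H - n%:R *: J| * `|D|)))).
  by ring.
rewrite ler_pdivlMl // -{1}(ger0_norm (ltW n0R)) -mx_normZ nD.
apply: le_trans (mx_norm_mulmx_le _ _) _.
rewrite ler_wpM2l // ler_wpM2l // (le_trans (ler_normB _ _)) //.
by rewrite normrN lerD2l mx_norm_mulmx_le.
Qed.

(* [n J D = - H D - (- H - n J) D] has size [o(1/n) + O(sqrt n) O(1/n)]. *)
Lemma littleop_newton (R : realType) dX (X : measurableType dX) d
    (P : forall n, probability (n.-tuple X) R) (J : 'M[R]_d)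
    (H : forall n, n.-tuple X -> 'M[R]_d) (D : forall n, n.-tuple X -> 'cV[R]_d) :
  J \in unitmx ->
  bigOp P (fun n x => n%:R *: D n x) (fun=> 1) ->
  bigOp P (fun n x => - H n x - n%:R *: J) (fun n => Num.sqrt n%:R) ->
  littleop P (fun n x => H n x *m D n x) (fun n => n%:R^-1) ->
  littleop P D (fun n => n%:R^-1).
Proof.
move=> Ju DO HO /littleopP HDo; apply/littleopP => e h e0 h0.
have h4 : 0 < h / 4 by rewrite divr_gt0.
have [M1 PM1] := DO _ h4; have [M2 PM2] := HO _ h4.
pose C := d%:R * `|invmx J|.
near=> n; have n0 : (0 < n)%N by near: n; exists 1%N.
have n0R : 0 < n%:R :> R by rewrite ltr0n.
(* Off three exceptional events the bound of [newton_step_le] is deterministic. The threshold [1]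
   for [H D] suffices, since that bound carries a further factor [1 / n]. *)
apply: (@le_trans _ _ ((P n)^*%mu ([set x | M1 * 1 < `|n%:R *: D n x| ]%R `|`
   [set x | M2 * Num.sqrt n%:R < `|- H n x - n%:R *: J| ]%R `|`
   [set x | 1 * n%:R^-1 < `|H n x *m D n x| ]%R))); last first.
  apply: (@le_trans _ _ (h / 4 + h / 4 + h / 4)%:E); last by rewrite lee_fin; lra.
  by apply: mu_extU_le; [apply: mu_extU_le|]; near: n => //; exact: HDo.
apply: le_mu_ext => x /= eD; apply/not_notP => /not_orP[/not_orP[]].
move=> /negP; rewrite -leNgt mulr1 => D1 /negP; rewrite -leNgt => H2.
move=> /negP; rewrite -leNgt mul1r => HD1; move: eD; apply/negP; rewrite -leNgt.
apply: le_trans (newton_step_le (H n x) (D n x) n0 Ju) _.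
rewrite -/C.
have Dn : `|D n x| <= M1 / n%:R.
  by rewrite ler_pdivlMr // mulrC -{1}(ger0_norm (ltW n0R)) -mx_normZ.
have C0 : 0 <= C by rewrite mulr_ge0.
(* Off the exceptional events the Newton bound is [1 / n] times this quantity, which tends to 0. *)
have : C * (n%:R^-1 + d%:R * M1 * M2 * (Num.sqrt n%:R)^-1) <= e.
  near: n.
  have : C * (n%:R^-1 + d%:R * M1 * M2 * (Num.sqrt n%:R)^-1) @[n --> \oo] --> 0.
    rewrite -(mulr0 C); apply: cvgMl_tmp; rewrite -[X in _ --> X]addr0.
    apply: cvgD; first exact: cvg_natr_inv.
    by rewrite -(mulr0 (d%:R * M1 * M2)); apply: cvgMl_tmp; exact: cvg_sqrtr_inv.
  move=> /cvgrPdist_le /(_ e e0); apply: filterS => k; rewrite sub0r normrN.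
  exact: le_trans (ler_norm _).
move=> Ce; apply: le_trans (_ : _ <=
  C / n%:R * (n%:R^-1 + d%:R * (M2 * Num.sqrt n%:R * (M1 / n%:R)))) _.
  rewrite ler_wpM2l ?divr_ge0 ?(ltW n0R) // lerD // ler_wpM2l // ler_pM //.
have -> : M2 * Num.sqrt n%:R * (M1 / n%:R) = M1 * M2 * (Num.sqrt n%:R)^-1.
  rewrite -{2}(sqr_sqrtr (ltW n0R)); field.
  by rewrite gt_eqF // sqrtr_gt0.
rewrite mulrAC !mulrA.
by rewrite ler_pM2r ?invr_gt0 // -!mulrA -mulrA.
Unshelve. all: by end_near. Qed.

(** * The penalty under the two priors *)

Lemma ln_sqrtr (R : realType) (x : R) : 0 < x -> ln (Num.sqrt x) = 2^-1 * ln x.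
Proof.
move=> x0; rewrite -{2}(sqr_sqrtr (ltW x0)) lnXn ?sqrtr_gt0 //; lra.
Qed.

(** Minus the log prior contributes minus half the log-determinant, which cancels the information
    term. *)
Lemma pen_prior_sqrt_det (R : realType) d (prior : 'cV[R]_d -> R)
    (I : 'cV[R]_d -> 'M[R]_d) (c : R) (t : 'cV[R]_d) :
  0 < c -> 0 < \det (I t) -> prior t = c * Num.sqrt (\det (I t)) ->
  pen prior I t = (- ln c)%:E.
Proof.
move=> c0 D0 pt; have S0 : 0 < Num.sqrt (\det (I t)) by rewrite sqrtr_gt0.
rewrite /pen pt !lne_EFin ?mulr_gt0 // lnM // ln_sqrtr //.
by rewrite -EFinN -EFinM -EFinD; congr EFin; ring.
Qed.

Lemma pen_prior_det (R : realType) d (prior : 'cV[R]_d -> R)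
    (I : 'cV[R]_d -> 'M[R]_d) (c : R) (t : 'cV[R]_d) :
  0 < c -> 0 < \det (I t) -> prior t = c * \det (I t) ->
  pen prior I t = (- ln c - 2^-1 * ln (\det (I t)))%:E.
Proof.
move=> c0 D0 pt; rewrite /pen pt !lne_EFin ?mulr_gt0 // lnM //.
by rewrite -EFinN -EFinM -EFinD; congr EFin; field.
Qed.

(** Where [L] is finite the two objectives are opposite up to a constant. Infinite values, such as a
    log-likelihood of [-oo], are compared case by case because they do not cancel. *)
Lemma argmin_argmax (T : Type) (R : realType) (D : set T) (L p q : T -> \bar R)
    (g : T -> R) (k l : R) (t : T) :
  (forall s, D s -> p s = (k - g s)%:E) -> (forall s, D s -> q s = (l + g s)%:E) ->
  is_argmin D (fun s => - L s + p s)%E t <-> is_argmax D (fun s => L s + q s)%E t.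
Proof.
move=> pk ql; have le_iff s u : D s -> D u ->
    (- L u + p u <= - L s + p s)%E = (L s + q s <= L u + q u)%E.
  move=> Ds Du; rewrite !pk // !ql //.
  case: (L s) => [a||]; case: (L u) => [b||] //=;
    rewrite -?EFinN -?EFinD ?lee_fin ?leNye ?leey //.
  by apply/idP/idP; lra.
by split=> -[Dt opt]; split=> // s Ds; have := opt s Ds; rewrite le_iff.
Qed.


(** * Gradients at maximisers and the penalty score *)

(** [fine] preserves order only between finite values, hence finiteness on a whole neighbourhood of
    [t]. *)
Lemma gradient_argmax (R : realType) d (D : set 'cV[R]_d) (f : 'cV[R]_d -> \bar R)
    (t : 'cV[R]_d) :
  is_argmax D f t -> (\forall s \near t, D s /\ f s \is a fin_num) ->
  has_partials (fine \o f) t -> gradient (fine \o f) t = 0.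
Proof.
move=> [_ fmax] Df df; apply/matrixP => i j; rewrite !mxE.
have [_ ft] := nbhs_singleton Df.
apply: derive_local_max (df i) _; apply: filterS Df => s [Ds fs] /=.
by apply: fine_le => //; exact: fmax.
Qed.

Lemma gradient_near_cst (R : realType) d (f : 'cV[R]_d -> R) (k : R) (t : 'cV[R]_d) :
  (\forall s \near t, f s = k) -> gradient f t = 0.
Proof.
move=> fk; apply/matrixP => i j; rewrite !mxE /partial.
by rewrite (near_eq_derive (g := cst k)) ?derive_cst.
Qed.

Lemma pen_score_prior_det (R : realType) d (prior : 'cV[R]_d -> R)
    (I : 'cV[R]_d -> 'M[R]_d) (c : R) (t : 'cV[R]_d) :
  0 < c ->
  (\forall s \near t, 0 < \det (I s) /\ prior s = c * \det (I s)) ->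
  has_partials (rpen prior I) t ->
  pen_score prior I t = 2^-1 *: gradient (fun s => ln (\det (I s))) t.
Proof.
move=> c0 nearI dpen; apply/matrixP => i j; rewrite !mxE /partial.
(* Solving the formula of [pen_prior_det] for the log-determinant gives its derivative from that of
   [rpen], so its differentiability is a consequence. *)
have lnE : \forall s \near t,
    ((-2) \*: (rpen prior I + cst (ln c))) s = ln (\det (I s)).
  apply: filterS nearI => s [D0 ps].
  by rewrite /= fctE /= /rpen (pen_prior_det c0 D0 ps) /= /GRing.scale /=; field.
rewrite -(near_eq_derive _ lnE).
have dsum : derivable (rpen prior I + cst (ln c)) t (delta_mx i 0).
  exact/derivableD/derivable_cst/dpen.
rewrite deriveZ // deriveD //.
by rewrite derive_cst addr0 /GRing.scale /=; field.
Qed.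

(** * From closeness in mean to integrability and bias *)

Lemma integrable_of_close (R : realType) dX (X : measurableType dX) d n
    (P : probability (n.-tuple X) R) (est est' : n.-tuple X -> 'cV[R]_d) :
  measurable_estimator est -> measurable_estimator est' ->
  integrable_estimator P est' ->
  (\int[P]_x (`|est x - est' x|)%:E < +oo)%E -> integrable_estimator P est.
Proof.
move=> m1 m2 int2 fin i.
have mD : measurable_fun setT (fun x => `|est x - est' x|).
  apply: measurable_mx_norm => j.
  under eq_fun do rewrite mxE [X in _ + X]mxE.
  exact: measurable_funB.
have -> : (fun x => (est x i 0)%:E) =
    ((fun x => (est' x i 0)%:E) \+ (fun x => ((est x - est' x) i 0)%:E))%E.
  by apply/funext => x /=; rewrite -EFinD !mxE; congr EFin; ring.
apply: integrableD => //.
apply: (@le_integrable _ _ _ P setT _ _ (fun x => (`|est x - est' x|)%:E)) => //.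
- apply/measurable_EFinP; under eq_fun do rewrite mxE [X in _ + X]mxE.
  exact: measurable_funB.
- by move=> x _; rewrite /= lee_fin normr_id mx_norm_coord_le.
apply/integrableP; split; first exact/measurable_EFinP.
by under eq_integral do rewrite /= normr_id.
Qed.

(** The centre [t0] cancels in the difference of biases, and each coordinate of the mean difference
    is at most the mean norm. *)
Lemma Bias_close (R : realType) dX (X : measurableType dX) d n
    (P : probability (n.-tuple X) R) (est est' : n.-tuple X -> 'cV[R]_d)
    (t0 : 'cV[R]_d) (c : R) :
  measurable_estimator est -> measurable_estimator est' ->
  integrable_estimator P est -> integrable_estimator P est' ->
  (\int[P]_x (`|est x - est' x|)%:E <= c%:E)%E ->
  `|Bias P est t0 - Bias P est' t0| <= c.
Proof.
move=> m1 m2 int1 int2 close.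
have c0 : 0 <= c by rewrite -lee_fin; apply: le_trans close; exact: integral_ge0.
apply/mx_norm_leP => // i j; rewrite !mxE unlock.
have int_sub (f : n.-tuple X -> 'cV[R]_d) : integrable_estimator P f ->
    P.-integrable setT (fun x => ((f x - t0) i 0)%:E).
  move=> fi; have -> : (fun x => ((f x - t0) i 0)%:E) =
      ((fun x => (f x i 0)%:E) \- (cst (t0 i 0)%:E))%E.
    by apply/funext => x; rewrite !mxE EFinB.
  by apply: integrableB => //; exact: finite_measure_integrable_cst.
rewrite -fineB ?integrable_fin_num //; try exact: int_sub.
rewrite -integralB //; try exact: int_sub.
have -> : (fun x => ((est x - t0) i 0)%:E - ((est' x - t0) i 0)%:E)%E =
    (fun x => ((est x - est' x) i 0)%:E).
  by apply/funext => x; rewrite -EFinB !mxE; congr EFin; ring.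
have mi : measurable_fun setT (fun x => ((est x - est' x) i 0)%:E).
  apply/measurable_EFinP; under eq_fun do rewrite mxE [X in _ + X]mxE.
  exact: measurable_funB.
have mD : measurable_fun setT (fun x => (`|est x - est' x|)%:E).
  apply/measurable_EFinP; apply: measurable_mx_norm => k.
  under eq_fun do rewrite mxE [X in _ + X]mxE.
  exact: measurable_funB.
have Ic : (`|\int[P]_x ((est x - est' x) i 0)%:E| <= c%:E)%E.
  apply: le_trans (le_abse_integral _ _ _) _ => //.
  apply: le_trans close; apply: ge0_le_integral => //.
  - exact: measurableT_comp.
  - by move=> x _; rewrite /= lee_fin mx_norm_coord_le.
by rewrite -fine_abse -?[leRHS]/(fine c%:E) ?fine_le //; move: Ic; case: (\int[P]_x _)%E.
Qed.

(** * Rescaling by the sample size *)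

Lemma bigOp_scale (R : realType) dX (X : measurableType dX)
    (V : normedModType R) (P : forall n, probability (n.-tuple X) R)
    (Z : forall n, n.-tuple X -> V) :
  bigOp P (fun n x => n%:R *: Z n x) (fun=> 1) <-> bigOp P Z (fun n => n%:R^-1).
Proof.
(* At [n = 0] the inverse is 0 by convention and the two events may differ; only large [n]
   matters. *)
have setE n M : (0 < n)%N -> [set x | M * 1 < `|n%:R *: Z n x|] =
    [set x | M * n%:R^-1 < `|Z n x|].
  move=> n0; apply/seteqP; split=> x /=;
    by rewrite mulr1 ltr_pdivrMr ?ltr0n // normrZ normr_nat mulrC.
split=> ZO e e0; have [M PM] := ZO e e0; exists M; near=> n;
  have n0 : (0 < n)%N by (near: n; exists 1%N).
- by rewrite -setE //; near: n.
- by rewrite setE //; near: n.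
Unshelve. all: by end_near. Qed.

Lemma littleop_scale (R : realType) dX (X : measurableType dX)
    (V : normedModType R) (P : forall n, probability (n.-tuple X) R)
    (Z : forall n, n.-tuple X -> V) :
  littleop P Z (fun n => n%:R^-1) -> littleop P (fun n x => n%:R *: Z n x) (fun=> 1).
Proof.
move=> /littleopP Zo; apply/littleopP => e h e0 h0; near=> n.
have n0 : (0 < n)%N by near: n; exists 1%N.
apply: (@le_trans _ _ ((P n)^*%mu [set x | e * n%:R^-1 < `|Z n x|]%R)); last first.
  by near: n; exact: Zo.
apply: le_mu_ext => x /=.
by rewrite mulr1 ltr_pdivrMr ?ltr0n // normrZ normr_nat mulrC.
Unshelve. all: by end_near. Qed.

(** * Comparison of the Wallace-Freeman, maximum likelihood and Firth estimators *)

Theorem corollary5p2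
    (R : realType) (dX : measure_display) (X : measurableType dX) (d : nat)
    (mu : {sigma_finite_measure set X -> \bar R})
    (Theta : set 'cV[R]_d) (theta0 : 'cV[R]_d)
    (p : X -> 'cV[R]_d -> R)
    (P : forall n, 'cV[R]_d -> probability (n.-tuple X) R)
    (nu : {measure set (g_sigma_algebraType (@open 'cV[R]_d)) -> \bar R})
    (prior : 'cV[R]_d -> R)
    (mle wf : forall n, n.-tuple X -> 'cV[R]_d) :
  let P0 n := P n theta0 in
  let ell n (x : n.-tuple X) := rloglik p x in
  let I := fisher p P in
  let K := info p P in
  let A := cox_snell_mx p P in
  let a := pen_score prior I in
  let codelength n (x : n.-tuple X) t := (- loglik p x t + pen prior I t)%E in
  (* the model, the prior and the estimators *)
  is_iid_model mu Theta p P ->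
  Theta° theta0 ->
  (forall t, Theta t -> 0 < \det (I t)) ->
  prior_density Theta nu prior ->
  (forall n, measurable_estimator (mle n)) ->
  (forall n, measurable_estimator (wf n)) ->
  (\forall n \near \oo, {ae P0 n, forall x, is_argmax Theta (loglik p x) (mle n x)}) ->
  (\forall n \near \oo, {ae P0 n, forall x, is_argmin Theta (codelength n x) (wf n x)}) ->
  (* C1 *)
  (exists2 U, nbhs theta0 U & \forall n \near \oo, {ae P0 n, forall x,
     (forall t, U t -> loglik p x t \is a fin_num) /\ C2_on U (ell n x)}) ->
  (\forall n \near \oo, {ae P0 n, forall x,
     [/\ Theta° (mle n x), has_partials (ell n x) (mle n x)
       & gradient (ell n x) (mle n x) = 0]}) ->
  (\forall n \near \oo, integrable_estimator (P0 n) (mle n)) ->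
  (fun n => Bias (P0 n) (mle n) theta0
     - invmx (K n theta0) *m A n theta0 *m vec (invmx (K n theta0)))
    =O_\oo (fun n => n%:R ^- 2 : R^o) ->
  (* C2 *)
  bigOp P0 (fun n x => - hessian (ell n x) (mle n x) - K n theta0)
    (fun n => Num.sqrt n%:R) ->
  (forall n, (0 < n)%N -> K n theta0 \in unitmx) ->
  (* C3 *)
  bigOp P0 (fun n x => mle n x - theta0) (fun n => (Num.sqrt n%:R)^-1) ->
  (* C4 *)
  (exists2 U, nbhs theta0 U &
     (forall t, U t -> pen prior I t \is a fin_num /\ has_partials (rpen prior I) t) /\
     forall i, C1_on U (fun t => a t i 0)) ->
  (* C5 *)
  littleop P0 (fun n x => gradient (ell n x) (wf n x) - gradient (ell n x) (mle n x)
     - hessian (ell n x) (mle n x) *m (wf n x - mle n x)) (fun n => n%:R^-1) ->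
  uniformly_integrable P0 (fun n x =>
     n%:R *: (wf n x - mle n x - invmx (K n theta0) *m a theta0)) ->
  (* prior proportional to |I|^(1/2) *)
  ((exists2 c : R, 0 < c & forall t, Theta t -> prior t = c * Num.sqrt (\det (I t))) ->
   [/\ forall t, Theta° t -> a t = 0,
       littleop P0 (fun n x => wf n x - mle n x) (fun n => n%:R^-1),
       \forall n \near \oo, integrable_estimator (P0 n) (wf n)
     & (fun n => Bias (P0 n) (wf n) theta0 - Bias (P0 n) (mle n) theta0)
         =o_\oo (fun n => n%:R^-1 : R^o)]) /\
  (* prior proportional to |I| *)
  ((exists2 c : R, 0 < c & forall t, Theta t -> prior t = c * \det (I t)) ->
   (forall t, Theta° t -> has_partials (rpen prior I) t ->
      a t = 2^-1 *: gradient (fun s => ln (\det (I s))) t) /\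
   (canonical_expfam Theta p ->
    forall n (x : n.-tuple X) t, (0 < n)%N ->
      is_argmin Theta (codelength n x) t <->
      is_argmax Theta (firth p P x) t)).
Proof.
move=> P0 ell I K A a codelength _ Theta0 detI _ m_mle m_wf mle_max wf_min
  [U U0 C1] C1' int_mle _ C2 _ C3 _ C5 ui.
have Theta_theta0 : Theta theta0 by exact: interior_subset Theta0.
split=> [[c c0 prior_c]|[c c0 prior_c]]; last first.
  split=> [t Theta_t dpen|_ n x t n0].
    apply: (pen_score_prior_det c0) => //; apply: filterS Theta_t => s Theta_s.
    by split; [exact: detI | exact: prior_c].
  (* Firth's term uses the determinant of [n I], which is [n ^ d] times that of [I]; this yields the
     constant [l]. *)
  apply: (@argmin_argmax _ _ _ _ _ _ (fun s => 2^-1 * ln (\det (I s)))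
    (- ln c) (2^-1 * ln (n%:R ^+ d))) => s Theta_s.
    by rewrite (pen_prior_det c0 (detI s Theta_s) (prior_c s Theta_s)).
  have Ds := detI s Theta_s.
  rewrite /info detZ lne_EFin; last by rewrite mulr_gt0 // exprn_gt0 // ltr0n.
  by rewrite lnM ?posrE ?exprn_gt0 ?ltr0n // -EFinM mulrDr.
have penE s : Theta s -> pen prior I s = (- ln c)%:E.
  by move=> Ts; exact: pen_prior_sqrt_det c0 (detI s Ts) (prior_c s Ts).
have a0 t : Theta° t -> a t = 0.
  move=> Theta_t; rewrite /a /pen_score (@gradient_near_cst _ _ _ (- ln c)) ?oppr0 //.
  by apply: filterS Theta_t => s Ts; rewrite /rpen penE.
pose D n (x : n.-tuple X) := wf n x - mle n x.
have mD n : measurable_fun setT (fun x => `|D n x|).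
  apply: measurable_mx_norm => i; under eq_fun do rewrite mxE [X in _ + X]mxE.
  by apply: measurable_funB; [exact: m_wf | exact: m_mle].
have mnD n : measurable_fun setT (fun x => `|n%:R *: D n x|).
  under eq_fun do rewrite normrZ.
  by apply: measurable_funM; [exact: measurable_cst | exact: mD].
(* The centring term in C5 vanishes because [a theta0 = 0]. *)
have uiD : uniformly_integrable P0 (fun n x => n%:R *: D n x).
  move=> e e0; have [M PM] := ui e e0; exists M; apply: filterS PM => n.
  by rewrite a0 // mulmx0; under eq_integral do rewrite subr0;
    under [X in integral _ X _]eq_set do rewrite subr0.
have J_unit : I theta0 \in unitmx.
  by rewrite unitmxE unitfE gt_eqF // detI.
have DO1 := uniformly_integrable_bigOp mnD uiD.
have Do1 : littleop P0 D (fun=> 1).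
  by apply: bigOp_cvg0 (@cvg_natr_inv R); apply/bigOp_scale.
have mle_o1 := bigOp_cvg0 C3 (@cvg_sqrtr_inv R).
have score0 : forall h : R, 0 < h -> \forall n \near \oo,
    ((P0 n)^*%mu [set x | ~ (gradient (ell n x) (wf n x) = 0 /\
                           gradient (ell n x) (mle n x) = 0)]%R <= h%:E)%E.
  move=> h h0.
  have /nbhs_ballP[r /= r0 ballr] : nbhs theta0 (U `&` Theta)°.
    by apply: nbhs_interior; exact: filterI.
  (* Two distances of at most [r / 3] keep [wf] strictly inside the ball of radius [r]. [B1] and
     [B2] cost [h / 2] each; [N1], [N2] and [N3] are negligible. *)
  have r3 : 0 < r / 3 by rewrite divr_gt0.
  have h2 : 0 < h / 2 by rewrite divr_gt0.
  pose B1 n := [set x : n.-tuple X | r / 3 * 1 < `|D n x|].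
  pose B2 n := [set x : n.-tuple X | r / 3 * 1 < `|mle n x - theta0|].
  pose N1 n := [set x : n.-tuple X | ~ is_argmin Theta (codelength n x) (wf n x)].
  pose N2 n := [set x : n.-tuple X | ~ ((forall t, U t -> loglik p x t \is a fin_num) /\
     C2_on U (ell n x))].
  pose N3 n := [set x : n.-tuple X | ~ [/\ Theta° (mle n x),
       has_partials (ell n x) (mle n x) & gradient (ell n x) (mle n x) = 0]].
  near=> n.
  apply: (@le_trans _ _
    ((P0 n)^*%mu ((((B1 n `|` B2 n) `|` N1 n) `|` N2 n) `|` N3 n))); last first.
    rewrite (_ : h = h / 2 + h / 2 + 0 + 0 + 0); last by rewrite !addr0 -splitr.
    apply: mu_extU_le; [apply: mu_extU_le; [apply: mu_extU_le; [apply: mu_extU_le|]|]|].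
    - by near: n; exact: (littleopP _ _ _).1 Do1 _ _ r3 h2.
    - by near: n; exact: (littleopP _ _ _).1 mle_o1 _ _ r3 h2.
    - by rewrite mu_ext_negligible //; near: n.
    - by rewrite mu_ext_negligible //; near: n.
    - by rewrite mu_ext_negligible //; near: n.
  apply: le_mu_ext => x /=; apply: contra_notP.
  move=> /not_orP[/not_orP[/not_orP[/not_orP[]]]].
  rewrite /B1 /B2 /N1 /N2 /N3 /= !mulr1 => /negP; rewrite -leNgt => Dr.
  move=> /negP; rewrite -leNgt => mler.
  move=> /contrapT wfx /contrapT[Ufin [C1U _]] /contrapT[_ _ g0].
  split=> //.
  have wfW : (U `&` Theta)° (wf n x).
    apply: ballr; rewrite -ball_normE /= distrC.
    rewrite (_ : wf n x - theta0 = D n x + (mle n x - theta0));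
      last by rewrite addrA subrK.
    apply: le_lt_trans (ler_normD _ _) _; lra.
  apply: (@gradient_argmax _ _ Theta (loglik p x)).
  (* With a constant penalty, [argmin_argmax] applies with [g = 0] and [q = 0]: [wf] also maximises
     the likelihood. *)
  - have : is_argmax Theta (fun s => loglik p x s + 0)%E (wf n x).
      by apply/(@argmin_argmax _ _ _ _ (pen prior I) (cst 0%E) (cst 0) (- ln c) 0) => //;
        [move=> s /penE ->; rewrite subr0 | move=> s _; rewrite /= addr0].
    by case=> Tw wmax; split=> // s Ts; have := wmax s Ts; rewrite !adde0.
  - by apply: filterS wfW => s [Us Ts]; split=> //; exact: Ufin.
  - by apply: (C1U _ _).1; exact: (interior_subset wfW).1.
have HDo : littleop P0 (fun n x => hessian (ell n x) (mle n x) *m D n x)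
    (fun n => n%:R^-1).
  have /littleopP HDo : littleop P0 (fun n x => - (hessian (ell n x) (mle n x) *m D n x))
      (fun n => n%:R^-1).
    (* Once both scores vanish, the Taylor remainder is exactly minus the Hessian applied to [D]. *)
    apply: littleop_eq C5 => h /score0; apply: filterS => n; apply: le_trans.
    by apply: le_mu_ext => x /= neq [g0 g0']; apply: neq; rewrite g0 g0' subrr sub0r.
  apply/littleopP => e h e0 h0; apply: filterS (HDo e h e0 h0) => n; apply: le_trans.
  by apply: le_mu_ext => x /=; rewrite normrN.
have Do : littleop P0 D (fun n => n%:R^-1) by exact: littleop_newton J_unit DO1 C2 HDo.
have ED := uniformly_integrable_cvg0 mnD uiD (littleop_scale Do).
have EDn e : 0 < e ->
    \forall n \near \oo, (\int[P0 n]_x (`|D n x|)%:E <= (e / n%:R)%:E)%E.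
  (* The mean of [n] times the norm of [D] is eventually at most [e]; dividing by [n] gives the rate
     required for the bias. *)
  move=> e0; near=> n; have n0 : 0 < n%:R :> R by rewrite ltr0n; near: n; exists 1%N.
  rewrite EFinM lee_pdivlMr // muleC -ge0_integralZl_EFin //.
  - under eq_integral do rewrite -EFinM -{1}(ger0_norm (ltW n0)) -normrZ.
    by near: n; exact: ED.
  - by apply/measurable_EFinP; exact: mD.
have int_wf : \forall n \near \oo, integrable_estimator (P0 n) (wf n).
  near=> n; apply: integrable_of_close (m_wf n) (m_mle n) _ _; first by near: n.
  apply: le_lt_trans (ltry (1 / n%:R)); near: n; exact: EDn.
split=> //.
apply/eqoP => e e0; near=> n.
rewrite /= ger0_norm ?invr_ge0 //; apply: Bias_close; rewrite //; near: n => //.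
exact: EDn.
Unshelve. all: by end_near. Qed.
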